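(* Suppose that $\mathcal{L}=\{A_\xi:\xi<\omega_1\}$ is a Luzin family, $\mathcal{A}$ is an almost disjoint family of subsets of $\mathbb{N}$ such that $\mathcal{L}\subseteq\mathcal{A}$, $\mathcal{X}$ is a Banach space, and $T:\mathcal{X}_{\mathcal{A}}\to\mathcal{X}$ is a bounded linear operator with separable range. Then the unit sphere of $(\mathcal{X}_{\mathcal{A}},\|\cdot\|_T)$ admits an uncountable $(1+\frac12)$-separated set.
   Context: Banach spaces are real and infinite dimensional. A family of subsets of $\mathbb{N}$ is almost disjoint if any two distinct members have finite intersection; all almost disjoint families considered are uncountable and consist of infinite sets. An almost disjoint family $\{A_\xi:\xi<\omega_1\}$ (with $A_\xi\neq A_\eta$ for $\xi\ne\eta$) is called a Luzin family if for every $\alpha<\omega_1$ the function $\alpha\to\mathbb{N}$ given by $\beta\mapsto\max(A_\beta\cap A_\alpha)$, $\beta<\alpha$, is finite-to-one (with the convention $\max\emptyset=0$). For an almost disjoint family $\mathcal{A}$, $\mathcal{X}_{\mathcal{A}}$ is the closed linear span in $(\ell_\infty(\mathbb{N}),\|\cdot\|_\infty)$ of $\{1_A:A\in\mathcal{A}\}\cup c_0$, where $1_A$ is the characteristic function of $A$; boundedness of $T$ is with respect to $\|\cdot\|_\infty$ on $\mathcal{X}_{\mathcal{A}}$. The norm $\|\cdot\|_T$ on $\mathcal{X}_{\mathcal{A}}$ is $\|x\|_T=\|x\|_\infty+\|T(x)\|_{\mathcal{X}}$. For $r>0$, a subset $\mathcal{Y}$ of a Banach space is $r$-separated if $\|y-y'\|\ge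 r$ for any two distinct $y,y'\in\mathcal{Y}$. *)

(* Defs.v *)
From HB Require Import structures.
From mathcomp Require Import all_boot all_order all_algebra.
From mathcomp Require Import all_classical all_reals all_analysis.
From mathcomp Require Import wochoice.

Set Implicit Arguments.
Unset Strict Implicit.
Unset Printing Implicit Defensive.

Import Order.TTheory GRing.Theory Num.Theory.
Import numFieldNormedType.Exports.

Local Open Scope classical_set_scope.
Local Open Scope ring_scope.

(* A well-order is isomorphic to omega_1 iff it is uncountable and all its
   proper initial segments are countable. *)
Definition is_omega1 (d : Order.disp_t) (W : orderType d) : Prop :=
  [/\ well_order (<=%O : rel W),
      ~ countable [set: W] &
      forall a : W, countable [set b : W | (b < a)%O]].

(* By convention almost disjoint families are uncountable and consist of
   infinite sets. *)
Definition almost_disjoint_family (AA : set (set nat)) : Prop :=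
  [/\ ~ countable AA,
      forall A, AA A -> infinite_set A &
      forall A B, AA A -> AA B -> A <> B -> finite_set (A `&` B)].

(* Meaningful for finite A only; equal to 0 when A is empty. *)
Definition set_max (A : set nat) : nat := (\big[maxn/0%N]_(k \in A) k)%N.

Definition finite_to_one (U V : Type) (D : set U) (f : U -> V) : Prop :=
  forall v, finite_set (D `&` f @^-1` [set v]).

Definition luzin_family (d : Order.disp_t) (W : orderType d)
    (A : W -> set nat) : Prop :=
  [/\ almost_disjoint_family (range A),
      injective A &
      forall a : W,
        finite_to_one [set b | (b < a)%O] (fun b => set_max (A b `&` A a))].

Section linf.
Context (R : realType).

Definition bounded_seq : {pred nat -> R} := mem (bounded_fun : set (nat -> R)).

Lemma bounded_seqP (f : nat -> R) :
  reflect (exists M : R, forall n, `|f n| <= M) (f \in bounded_seq).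
Proof.
apply: (iffP idP) => [|[M fM]].
  rewrite inE => -[M [_ fM]]; exists (M + 1) => n.
  by apply: fM => //; rewrite ltrDl.
rewrite inE; exists M; split=> [|x Mx n _]; first exact: num_real.
exact: le_trans (fM n) (ltW Mx).
Qed.

Lemma bounded_seq_submod_closed : submod_closed bounded_seq.
Proof.
split=> [|a f g /bounded_seqP[M fM] /bounded_seqP[N gN]].
  by apply/bounded_seqP; exists 0 => n; rewrite normr0.
apply/bounded_seqP; exists (`|a| * M + N) => n.
rewrite (le_trans (ler_normD _ _))// lerD//.
by rewrite normrM ler_wpM2l.
Qed.

HB.instance Definition _ :=
  GRing.isSubmodClosed.Build R (nat -> R) bounded_seq bounded_seq_submod_closed.

Definition linf : Type := {f : nat -> R | f \in bounded_seq}.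

HB.instance Definition _ := SubChoice.on linf.
HB.instance Definition _ := [SubChoice_isSubLmodule of linf by <:].

Definition linf_norm (x : linf) : R := sup (range (fun n => `|val x n|)).

Let has_sup_linf (x : linf) : has_sup (range (fun n => `|val x n|)).
Proof.
split; first by exists `|val x 0%N|, 0%N.
by have /bounded_seqP[M xM] := valP x; exists M => _ [n _ <-].
Qed.

Lemma le_linf_norm (x : linf) (n : nat) : `|val x n| <= linf_norm x.
Proof. by apply: sup_upper_bound; [exact: has_sup_linf|exists n]. Qed.

Lemma linf_norm_le (x : linf) (M : R) :
  (forall n, `|val x n| <= M) -> linf_norm x <= M.
Proof.
move=> xM; apply: sup_le_ub; first by have [] := has_sup_linf x.
by move=> _ [n _ <-].
Qed.

Lemma linf_normD (x y : linf) : linf_norm (x + y) <= linf_norm x + linf_norm y.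
Proof.
apply: linf_norm_le => n.
by rewrite raddfD/= (le_trans (ler_normD _ _))// lerD// le_linf_norm.
Qed.

Lemma linf_normZ (a : R) (x : linf) : linf_norm (a *: x) = `|a| * linf_norm x.
Proof.
have le b (y : linf) : linf_norm (b *: y) <= `|b| * linf_norm y.
  apply: linf_norm_le => n.
  by rewrite linearZ/= normrM ler_wpM2l// le_linf_norm.
apply/le_anti; rewrite le/=; have [->|a0] := eqVneq a 0.
  by rewrite normr0 mul0r (le_trans _ (le_linf_norm _ 0%N)).
rewrite -ler_pdivlMl ?normr_gt0// -normfV.
by apply: (le_trans _ (le _ _)); rewrite scalerA mulVf// scale1r.
Qed.

Lemma linf_norm_eq0 (x : linf) : linf_norm x = 0 -> x = 0.
Proof.
move=> x0; apply/val_inj/funext => n; rewrite raddf0.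
by apply/normr0_eq0/le_anti; rewrite normr_ge0 andbT -x0 le_linf_norm.
Qed.

HB.instance Definition _ := Lmodule_isNormed.Build R linf
  linf_normD linf_normZ linf_norm_eq0.

End linf.

Section closed_span.
Context (R : realType) (V : normedModType R).

Definition linear_span (S : set V) : set V :=
  [set x | exists (n : nat) (c : 'I_n -> R) (v : 'I_n -> V),
     (forall i, S (v i)) /\ x = \sum_(i < n) c i *: v i].

Definition closed_span (S : set V) : {pred V} := mem (closure (linear_span S)).

Lemma linear_spanD (S : set V) (a : R) (x y : V) :
  linear_span S x -> linear_span S y -> linear_span S (a *: x + y).
Proof.
move=> [m [c [v [Sv ->]]]] [n [c' [v' [Sv' ->]]]].
exists (m + n)%N, (fun i : 'I_(m + n) => match fintype.split i with inl j => a * c j | inr j => c' j end),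
  (fun i : 'I_(m + n) => match fintype.split i with inl j => v j | inr j => v' j end); split.
  by move=> i; case: (fintype.split i).
rewrite big_split_ord/= scaler_sumr; congr (_ + _); apply: eq_bigr => i _.
  by rewrite (unsplitK (inl i)) scalerA.
by rewrite (unsplitK (inr i)).
Qed.

Lemma closed_spanP (S : set V) (x : V) :
  reflect (forall e : R, 0 < e -> exists2 y, linear_span S y & `|x - y| < e)
          (x \in closed_span S).
Proof.
apply: (iffP idP) => [|xS].
  rewrite inE => clx e e0; have [y [Sy]] := clx _ (nbhsx_ballx x e e0).
  by rewrite -ball_normE => xy; exists y.
rewrite inE => B /nbhs_ballP[e /= e0 xeB]; have [y Sy xy] := xS _ e0.
by exists y; split=> //; apply: xeB; rewrite -ball_normE.
Qed.

Lemma closed_span_submod_closed (S : set V) : submod_closed (closed_span S).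
Proof.
split=> [|a x y /closed_spanP xS /closed_spanP yS].
  apply/closed_spanP => e e0; exists 0; last by rewrite subrr normr0.
  exists 0%N, (fun=> 0), (fun=> 0); split; first by case.
  by rewrite big_ord0.
apply/closed_spanP => e e0.
have d0 : 0 < e / 2 / (`|a| + 1) by rewrite !divr_gt0// ltr_wpDl.
have e20 : 0 < e / 2 by rewrite divr_gt0.
have [x' Sx' xx'] := xS _ d0; have [y' Sy' yy'] := yS _ e20.
exists (a *: x' + y'); first exact: linear_spanD.
rewrite opprD addrACA -scalerBr (le_lt_trans (ler_normD _ _))//.
rewrite [ltRHS]splitr ler_ltD// normrZ.
have a1 : 0 < `|a| + 1 by rewrite ltr_wpDl.
rewrite (@le_trans _ _ ((`|a| + 1) * `|x - x'|))//.
  by rewrite ler_wpM2r// lerDl.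
by rewrite -ler_pdivlMl// mulrC ltW.
Qed.

HB.instance Definition _ (S : set V) :=
  GRing.isSubmodClosed.Build R V (closed_span S) (closed_span_submod_closed S).

Definition closed_span_space (S : set V) : Type :=
  {x : V | x \in closed_span S}.

HB.instance Definition _ (S : set V) := SubChoice.on (closed_span_space S).
HB.instance Definition _ (S : set V) :=
  [SubChoice_isSubLmodule of closed_span_space S by <:].

Definition closed_span_norm (S : set V) (x : closed_span_space S) : R :=
  `|val x|.

Lemma closed_span_normD (S : set V) (x y : closed_span_space S) :
  closed_span_norm (x + y) <= closed_span_norm x + closed_span_norm y.
Proof. by rewrite /closed_span_norm raddfD ler_normD. Qed.

Lemma closed_span_normZ (S : set V) (a : R) (x : closed_span_space S) :
  closed_span_norm (a *: x) = `|a| * closed_span_norm x.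
Proof. by rewrite /closed_span_norm linearZ normrZ. Qed.

Lemma closed_span_norm_eq0 (S : set V) (x : closed_span_space S) :
  closed_span_norm x = 0 -> x = 0.
Proof. by move=> /normr0_eq0 x0; apply/val_inj; rewrite raddf0. Qed.

HB.instance Definition _ (S : set V) :=
  Lmodule_isNormed.Build R (closed_span_space S)
    (@closed_span_normD S) (@closed_span_normZ S) (@closed_span_norm_eq0 S).

End closed_span.

Definition indicators (R : realType) (AA : set (set nat)) : set (linf R) :=
  [set x : linf R | exists2 A, AA A & val x = \1_A].

Definition c0 (R : realType) : set (linf R) :=
  [set x : linf R | val x @ \oo --> (0 : R)].

Definition XA (R : realType) (AA : set (set nat)) : normedModType R :=
  closed_span_space (@indicators R AA `|` @c0 R).

Definition infinite_dimensional (R : realType) (V : lmodType R) : Prop :=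
  forall (n : nat) (v : 'I_n -> V),
    exists x : V, forall c : 'I_n -> R, x <> \sum_(i < n) c i *: v i.

Definition bounded_operator (R : realType) (V W : normedModType R)
    (T : V -> W) : Prop :=
  exists M : R, forall x, `|T x| <= M * `|x|.

Definition separable_set (X : topologicalType) (A : set X) : Prop :=
  exists D : set X, [/\ countable D, D `<=` A & A `<=` closure D].

Definition norm_of (R : realType) (V W : normedModType R) (T : V -> W) (x : V)
  : R := `|x| + `|T x|.

(* The norm is a parameter so that a space may carry a norm other than its
   canonical one. *)
Definition unit_sphere (R : realType) (V : lmodType R) (N : V -> R) : set V :=
  [set x | N x = 1].

Definition r_separated (R : realType) (V : lmodType R) (N : V -> R) (r : R)
    (Y : set V) : Prop :=
  forall y y', Y y -> Y y' -> y <> y' -> r <= N (y - y').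

(* Main.v *)
(* Separability of the range of T gives an uncountable set C of indices on which
   the vectors T 1_(A a) are within 1/3 of each other. Send each a to some h a > a
   in C and put x_a = 1_(A a) - 1_(A (h a)): it has sup norm 1 and T-norm below
   4/3. After thinning out, the sets A a `&` A (h a) have a common bound n. Call
   b < a bad for a if A b meets A (h a) only below n. By the Luzin property each a
   has finitely many bad predecessors, so a greedy colouring with countably many
   colours yields an uncountable set without bad pairs, on which x_b - x_a takes
   the value 2. Dividing x_a by its T-norm leaves a separation of at least
   2 / (4/3) = 3/2. *)
Require Import Defs.
From mathcomp Require Import all_boot all_order all_algebra.
From mathcomp Require Import all_classical all_reals all_analysis.
From mathcomp Require Import wochoice lra.

Import Order.TTheory GRing.Theory Num.Theory.
Import numFieldNormedType.Exports.

Local Open Scope classical_set_scope.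
Local Open Scope ring_scope.

Lemma uncountable_fiber {W : Type} (D : set W) (f : W -> nat) :
  ~ countable D -> exists n, ~ countable (D `&` f @^-1` [set n]).
Proof.
move=> Dunc; apply: contrapT => /forallNP fiber; apply: Dunc.
have -> : D = \bigcup_n (D `&` f @^-1` [set n]).
  by apply/seteqP; split=> [a Da|a [n _ []]//]; exists (f a).
by apply: bigcup_countable => // n _; apply: contrapT (fiber n).
Qed.

Lemma countable_inj_image {U V : Type} (D : set U) (f : U -> V) :
  {in D &, injective f} -> countable (f @` D) -> countable D.
Proof.
move=> finj /countable_injP[g ginj]; apply/countable_injP.
exists (g \o f) => a b aD bD /= gfab; apply: finj => //.
by apply: ginj gfab; rewrite inE; [exists a|exists b] => //; rewrite -inE.
Qed.

Lemma finite_set_nat_bound (B : set nat) :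
  finite_set B -> exists n, forall k, B k -> (k < n)%N.
Proof.
move=> /finite_seqP[s ->]; exists (\max_(k <- s) k).+1 => k /= ks.
by rewrite ltnS (leq_bigmax_seq (F := id) k).
Qed.

(** The big operator runs over the finite support, or over the empty list, with value 0, when the
    support is infinite; the bound holds in both cases. *)
Lemma set_max_le (B : set nat) (n : nat) :
  (forall k, B k -> (k <= n)%N) -> (set_max B <= n)%N.
Proof.
rewrite /set_max => Bn.
case: finite_supportP => [_|Y YB _ _]; first by rewrite big_nil.
by apply/bigmax_leqP_seq => k kY _; apply/Bn/YB.
Qed.

(** Recursion by [Fix] needs accessibility, while [well_order] gives least elements: a least
    inaccessible point would have only accessible predecessors. *)
Lemma well_order_wf {d : Order.disp_t} {W : orderType d} :
  well_order (<=%O : rel W) -> well_founded (<%O : rel W).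
Proof.
move=> wo a; apply: contrapT => Na.
have [|m [[Nm mmin] _]] := wo [pred b : W | `[< ~ Acc (<%O : rel W) b >]].
  by exists a; apply/asboolP.
move/asboolP: Nm; apply; constructor => b bm.
apply: contrapT => Nb; move: bm; rewrite ltNge => /negP; apply.
by apply: mmin; apply/asboolP.
Qed.

(** Colour each point by a natural number that its [E]-predecessors avoid. Points of [D] related by
    [E] then differ in colour, and some colour class in [D] is uncountable. *)
Lemma uncountable_independent {d : Order.disp_t} {W : orderType d}
    (D : set W) (E : W -> W -> Prop) :
  well_order (<=%O : rel W) -> ~ countable D ->
  (forall a, D a -> finite_set [set b | (b < a)%O /\ E b a]) ->
  exists S : set W, [/\ S `<=` D, ~ countable S &
    forall b a, S b -> S a -> (b < a)%O -> ~ E b a].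
Proof.
move=> wo Dunc Efin.
have wf := well_order_wf wo.
(* The recursion visits all of [W]. If the predecessors of a point outside [D] use every colour,
   [get] returns a default, which does no harm. *)
pose fresh (B : set nat) : nat := get (~` B).
pose F a (col : forall b : W, (b < a)%O -> nat) : nat :=
  fresh [set n | exists (b : W) (ba : (b < a)%O), E b a /\ col b ba = n].
pose col := Fix wf (fun=> nat) F.
have colE a : col a = fresh (col @` [set b | (b < a)%O /\ E b a]).
  have Fext x (f g : forall b, (b < x)%O -> nat) :
      (forall b bx, f b bx = g b bx) -> F x f = F x g.
    by move=> fg; congr (F x _); do 2 apply: functional_extensionality_dep => ?.
  have -> : col a = F a (fun b _ => col b) by exact: Fix_eq.
  congr fresh; apply/seteqP; split=> n /=.
    by move=> [b [ba [Eba <-]]]; exists b.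
  by move=> [b [ba Eba] <-]; exists b, ba.
have [n Sunc] := uncountable_fiber D col Dunc.
exists (D `&` col @^-1` [set n]); split=> // b a [_ /= bn] [Da /= an] ba Eba.
have : (~` (col @` [set b | (b < a)%O /\ E b a])) (col a).
  rewrite colE; apply: getPex; apply: infinite_setN0.
  rewrite -setTD; apply: infinite_setD; first exact: infinite_nat.
  exact: finite_image (Efin a Da).
by apply; exists b => //; rewrite bn an.
Qed.

Definition coord {R : realType} {AA : set (set nat)} (x : XA R AA) : nat -> R :=
  val (val (x : closed_span_space (@indicators R AA `|` @c0 R))).

Lemma coordB {R : realType} {AA : set (set nat)} (x y : XA R AA) (k : nat) :
  coord (x - y) k = coord x k - coord y k.
Proof. by rewrite /coord !raddfB. Qed.

Lemma coordZ {R : realType} {AA : set (set nat)} (a : R) (x : XA R AA) (k : nat) :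
  coord (a *: x) k = a * coord x k.
Proof. by rewrite /coord !linearZ. Qed.

Lemma le_norm_coord {R : realType} {AA : set (set nat)} (x : XA R AA) (k : nat) :
  `|coord x k| <= `|x|.
Proof. exact: le_linf_norm. Qed.

Lemma norm_coord_le {R : realType} {AA : set (set nat)} (x : XA R AA) (M : R) :
  (forall k, `|coord x k| <= M) -> `|x| <= M.
Proof. exact: linf_norm_le. Qed.

Lemma exists_indicator (R : realType) (AA : set (set nat)) (B : set nat) :
  AA B -> exists x : XA R AA, coord x = \1_B.
Proof.
move=> AAB.
have bB : (\1_B : nat -> R) \in @bounded_seq R.
  apply/bounded_seqP; exists 1 => k.
  by rewrite indicE; case: (k \in B); rewrite ?normr1 ?normr0.
pose b : linf R := Sub (\1_B : nat -> R) bB.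
have bspan : b \in closed_span (@indicators R AA `|` @c0 R).
  apply/closed_spanP => e e0; exists b; last by rewrite subrr normr0.
  exists 1%N, (fun=> 1), (fun=> b); rewrite big_ord1 scale1r; split=> // _.
  by left; exists B.
by exists (Sub b bspan : closed_span_space _).
Qed.

(** Approximate each [f a] within [e / 2] by a point of a countable dense set; uncountably many [a]
    share the same point. *)
Lemma uncountable_close {R : realType} {X : normedModType R} {W : Type}
    (f : W -> X) (Z : set X) (D : set W) (e : R) :
  separable_set Z -> range f `<=` Z -> ~ countable D -> 0 < e ->
  exists2 C, C `<=` D /\ ~ countable C &
    forall a b, C a -> C b -> `|f a - f b| < e.
Proof.
move=> [Q [/countable_injP[g ginj] _ Zcl]] fZ Dunc e0.
have /choice[q qP] : forall a, exists q, Q q /\ `|f a - q| < e / 2.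
  move=> a; have fa : Z (f a) by apply: fZ; exists a.
  have e20 : 0 < e / 2 by rewrite divr_gt0.
  have [q [Qq]] := Zcl _ fa _ (nbhsx_ballx (f a) (e / 2) e20).
  by rewrite -ball_normE => faq; exists q.
have [n Cunc] := uncountable_fiber D (g \o q) Dunc.
exists (D `&` (g \o q) @^-1` [set n]); first by split=> // a [].
move=> a b [_ /= an] [_ /= bn]; have [Qa fa] := qP a; have [Qb fb] := qP b.
have qab : q a = q b by apply: ginj; rewrite ?inE// an bn.
rewrite (splitr e) (le_lt_trans (ler_distD (q a) _ _))// ltrD//.
by rewrite qab distrC.
Qed.

(* At k the function 1_(A b) - 1_(A (h b)) is 1 and 1_(A a) - 1_(A (h a)) is -1.
   Choosing h a > a bounds the predecessors of a by the Luzin property at h a,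
   whatever h does elsewhere. *)
Lemma luzin_partners {d : Order.disp_t} {W : orderType d} (A : W -> set nat)
    (C : set W) :
  is_omega1 W -> luzin_family A -> ~ countable C ->
  exists (h : W -> W) (S : set W),
    [/\ ~ countable S,
        forall a, S a -> [/\ C a, C (h a) & h a <> a] &
        forall b a, S b -> S a -> (b < a)%O ->
          exists k, [/\ A b k, A (h a) k, ~ A a k & ~ A (h b) k]].
Proof.
move=> [wo _ init] [[_ _ Aad] Ainj Aluz] Cunc.
have /choice[h hP] : forall a, exists b, C b /\ (a < b)%O.
  move=> a; apply: contrapT => /forallNP nb; apply: Cunc.
  (* Without an element above [a], all of [C] would lie in a countable initial segment together with
     [a]. *)
  apply: (@sub_countable _ _ _ ([set b | (b < a)%O] `|` [set a])).
    apply: subset_card_le => b Cb; have [ba|ab|->] := ltgtP b a; [by left| |by right].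
    by case: (nb b).
  rewrite -bigcup2E; apply: bigcup_countable => // -[|[|i]] _ /=.
  - exact: init.
  - exact: countable1.
  - exact: countable0.
have h_neq a : h a <> a by move=> ha; have [_] := hP a; rewrite ha ltxx.
have /choice[n nP] : forall a, exists n,
    forall k, (A a `&` A (h a)) k -> (k < n)%N.
  move=> a; apply: finite_set_nat_bound; apply: Aad; [by exists a|by exists (h a)|].
  by move=> /Ainj /esym; exact: h_neq.
have [m Dunc] := uncountable_fiber C n Cunc.
pose E b a := forall k, (A b `&` A (h a)) k -> (k <= m)%N.
have Efin a : finite_set [set b | (b < a)%O /\ E b a].
  (* Since [b < a < h a], a bad [b] lies in one of the [m + 1] finite fibres, over 0 to [m], of the
     Luzin function at [h a]. *)
  apply: (@sub_finite_set _ _ (\bigcup_(v in `I_m.+1)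
    ([set b | (b < h a)%O] `&` (fun b => set_max (A b `&` A (h a))) @^-1` [set v]))).
    move=> b [ba Eba]; exists (set_max (A b `&` A (h a))).
      exact: set_max_le Eba.
    by split=> //=; apply: (lt_trans ba); have [] := hP a.
  by apply: bigcup_finite => // v _; exact: Aluz.
have [S [SD Sunc Sind]] :=
  uncountable_independent _ E wo Dunc (fun a _ => Efin a).
exists h, S; split=> // [a /SD[Ca _]|b a Sb Sa ba].
  by split=> //; have [] := hP a.
(* A common point [k > m] of [A b] and [A (h a)] lies beyond both intersections of partners, hence
   in neither [A a] nor [A (h b)]. *)
have := Sind b a Sb Sa ba => /existsNP[k /not_implyP[[Abk Ahak] /negP]].
rewrite -ltnNge => mk; exists k.
have [[_ /= na] [_ /= nb]] := (SD a Sa, SD b Sb).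
split=> // [Aak|Ahbk].
  by have := nP a k (conj Aak Ahak); rewrite na ltnNge (ltnW mk).
by have := nP b k (conj Abk Ahbk); rewrite nb ltnNge (ltnW mk).
Qed.

Theorem proposition21 (R : realType) (d : Order.disp_t) (omega1 : orderType d)
    (homega1 : is_omega1 omega1)
    (A : omega1 -> set nat) (hL : luzin_family A)
    (AA : set (set nat)) (hAA : almost_disjoint_family AA)
    (hsub : range A `<=` AA)
    (X : completeNormedModType R) (hX : infinite_dimensional X)
    (T : {linear XA R AA -> X})
    (hbound : bounded_operator T) (hsep : separable_set (range T)) :
  exists Y : set (XA R AA),
    [/\ Y `<=` unit_sphere (norm_of T),
        ~ countable Y &
        r_separated (norm_of T) (1 + 2^-1) Y].
Proof.
have [_ Wunc _] := homega1.
have [[_ Ainf Aad] Ainj _] := hL.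
have /choice[e eE] : forall a, exists x : XA R AA, coord x = \1_(A a).
  by move=> a; apply/exists_indicator/hsub; exists a.
have Te_range : range (T \o e) `<=` range T by move=> _ [a _ <-]; exists (e a).
have e3 : 0 < 3^-1 :> R by rewrite invr_gt0.
have [C [_ Cunc] Cclose] := uncountable_close _ _ _ _ hsep Te_range Wunc e3.
have [h [S [Sunc hP sep]]] := luzin_partners A C homega1 hL Cunc.
pose x a := e a - e (h a).
have xE a k : coord (x a) k = \1_(A a) k - \1_(A (h a)) k by rewrite coordB !eE.
have x_le1 a : `|x a| <= 1.
  apply: norm_coord_le => k; rewrite xE !indicE.
  by do 2 case: (_ \in _); rewrite ?subrr ?subr0 ?sub0r ?normrN ?normr1 ?normr0.
have x_norm a : S a -> `|x a| = 1.
  move=> Sa; have [_ _ ha] := hP a Sa; apply/le_anti; rewrite x_le1/=.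
  have /infinite_setN0[k [Aak nAk]] : infinite_set (A a `\` (A a `&` A (h a))).
    apply: infinite_setD; first by apply: Ainf; exists a.
    by apply: Aad; [exists a|exists (h a)|move=> /Ainj/esym].
  apply: le_trans (le_norm_coord (x a) k).
  rewrite xE !indicE mem_set// memNset ?subr0 ?normr1//.
  by move=> Ahak; apply: nAk.
pose c a := norm_of T (x a).
have cP a : S a -> 1 <= c a < 4 / 3.
  move=> Sa; rewrite /c /norm_of x_norm// lerDl normr_ge0/=.
  have [Ca Cha _] := hP a Sa; have := Cclose _ _ Ca Cha.
  by rewrite /= -raddfB -/(x a); lra.
have cV a : S a -> 3 / 4 <= (c a)^-1.
  move=> /cP /andP[c1 c43].
  by rewrite -[3 / 4]invrK lef_pV2 ?posrE; lra.
pose y a := (c a)^-1 *: x a.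
have y_sphere a : S a -> norm_of T (y a) = 1.
  move=> Sa; have /andP[c1 _] := cP a Sa.
  rewrite /norm_of /y linearZ/= !normrZ -mulrDr ger0_norm ?invr_ge0; last by lra.
  by rewrite mulVf// gt_eqF//; lra.
have y_sep b a : S b -> S a -> (b < a)%O -> 1 + 2^-1 <= norm_of T (y b - y a).
  move=> Sb Sa ba; have [k [Abk Ahak nAak nAhbk]] := sep b a Sb Sa ba.
  apply: (@le_trans _ _ `|y b - y a|); last by rewrite /norm_of lerDl.
  (* The coordinate of [y b - y a] at [k] is the sum of the reciprocals of [c b] and [c a], each at
     least 3/4. *)
  apply: le_trans (le_norm_coord _ k).
  rewrite coordB !coordZ !xE !indicE (mem_set Abk) (mem_set Ahak).
  rewrite (memNset nAak) (memNset nAhbk) (le_trans _ (ler_norm _))//.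
  rewrite subr0 sub0r mulrN opprK !mulr1.
  by have := cV a Sa; have := cV b Sb; lra.
have y_sep' b a : S b -> S a -> b <> a -> 1 + 2^-1 <= norm_of T (y b - y a).
  move=> Sb Sa /eqP; rewrite neq_lt => /orP[|ab]; first exact: y_sep.
  rewrite (_ : norm_of T _ = norm_of T (y a - y b)); first exact: y_sep.
  by rewrite /norm_of !raddfB distrC [`|T _ - T _|]distrC.
exists (y @` S); split=> [_ [a Sa <-]| |_ _ [b Sb <-] [a Sa <-] yba].
- exact: y_sphere.
(* Separation makes [y] injective on [S]: equal values at distinct indices would have distance 0. *)
- move=> Ycount; apply/Sunc/(countable_inj_image _ _ _ Ycount) => b a.
  rewrite !inE => Sb Sa yba; apply: contrapT => ba.
  have := y_sep' b a Sb Sa ba.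
  by rewrite yba subrr /norm_of raddf0 !normr0; lra.
- by apply: y_sep' => // ba; apply: yba; rewrite ba.
Qed.
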